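(* Let $f:\mathbb{R}^n\to\mathbb{R}$ be a quadratic function, and let $Q_{k-1}^+$ be the (previous) bivariate quadratic model as described in the context. If $Q_k$ is a solution of the problem $$\min_{Q}\ \int_{-\infty}^{\infty}\bigl(Q(\alpha,0)-Q_{k-1}^+(\alpha,0)\bigr)^2\,d\alpha\quad\text{subject to}\quad Q\bigl(\mathcal T(\boldsymbol z)\bigr)=f(\boldsymbol z)\ \ \forall\,\boldsymbol z\in\{\boldsymbol x_k,\boldsymbol y_1^{(k)},\boldsymbol y_2^{(k)},\boldsymbol y_3^{(k)}\},$$ where $Q$ ranges over real quadratic functions (polynomials of degree at most 2) of two variables $(\alpha,\beta)$, then $$\int_{-\infty}^{\infty}\bigl(Q_k(\alpha,0)-\tilde f(\alpha,0)\bigr)^2d\alpha=\int_{-\infty}^{\infty}\bigl(Q_{k-1}^+(\alpha,0)-\tilde f(\alpha,0)\bigr)^2d\alpha-\int_{-\infty}^{\infty}\bigl(Q_k(\alpha,0)-Q_{k-1}^+(\alpha,0)\bigr)^2d\alpha,$$ where $\tilde f=f\circ\mathcal T^{-1}$, i.e. $\tilde f(\alpha,\beta)=f(\boldsymbol x_k+\alpha\boldsymbol d_1^{(k)}+\beta\boldsymbol d_2^{(k)})$.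
   Context: Fixed data: $\boldsymbol x_k\in\mathbb{R}^n$, $\Delta_k>0$, and orthonormal vectors $\boldsymbol d_1^{(k)},\boldsymbol d_2^{(k)}\in\mathbb{R}^n$. The map $\mathcal T=\mathcal T^{(k)}_{\boldsymbol d_1^{(k)},\boldsymbol d_2^{(k)}}$ sends $\boldsymbol y\in\boldsymbol x_k+\operatorname{span}\{\boldsymbol d_1^{(k)},\boldsymbol d_2^{(k)}\}$ to $(\langle\boldsymbol y-\boldsymbol x_k,\boldsymbol d_1^{(k)}\rangle,\langle\boldsymbol y-\boldsymbol x_k,\boldsymbol d_2^{(k)}\rangle)^\top\in\mathbb{R}^2$; it is a bijection. The interpolation points are $\boldsymbol y_1^{(k)}=\boldsymbol x_k+\Delta_k\boldsymbol d_2^{(k)}$; $\boldsymbol y_2^{(k)}=\boldsymbol x_k+2\Delta_k\boldsymbol d_2^{(k)}$ if $f(\boldsymbol y_1^{(k)})\le f(\boldsymbol x_k)$ and $\boldsymbol y_2^{(k)}=\boldsymbol x_k-\Delta_k\boldsymbol d_2^{(k)}$ otherwise; and $\boldsymbol y_3^{(k)}=\boldsymbol y_{\min}+\Delta_k\boldsymbol d_1^{(k)}$, where $\boldsymbol y_{\min}$ is a minimizer of $f$ over $\{\boldsymbol y_1^{(k)},\boldsymbol y_2^{(k)}\}$. $Q_{k-1}^+$ is a real polynomial of degree at most 2 in two variables with $Q_{k-1}^+(0,0)=f(\boldsymbol x_k)$; it is the model from the previous iteration of the method, obtained by interpolating $f$ at six points (for which quadratic interpolation is uniquely solvable) of the previous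 iteration's two-dimensional affine subspace, which contains $\boldsymbol x_k+\operatorname{span}\{\boldsymbol d_1^{(k)}\}$, written in coordinates in which the point $\boldsymbol x_k+\alpha\boldsymbol d_1^{(k)}$ corresponds to $(\alpha,0)$. Integrals of nonnegative functions over $\mathbb{R}$ take values in $[0,+\infty]$, with the usual extended-real arithmetic. *)

(* Defs.v *)
From HB Require Import structures.
From mathcomp Require Import all_boot all_order all_algebra.
From mathcomp Require Import all_classical all_reals all_analysis.

Set Implicit Arguments.
Unset Strict Implicit.
Unset Printing Implicit Defensive.

Import Order.TTheory GRing.Theory Num.Theory.
Local Open Scope classical_set_scope.
Local Open Scope ring_scope.

Definition dot {R : realType} {n : nat} (u v : 'cV[R]_n) : R :=
  (u^T *m v) ord0 ord0.

Definition orthonormal2 {R : realType} {n : nat} (d1 d2 : 'cV[R]_n) : Prop :=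
  [/\ dot d1 d1 = 1, dot d2 d2 = 1 & dot d1 d2 = 0].

(* Polynomial functions of total degree at most 2.  No symmetry is required
   of [H]: replacing it by its symmetric part gives the same function. *)
Definition quadratic {R : realType} {n : nat} (q : 'cV[R]_n -> R) : Prop :=
  exists (c : R) (g : 'cV[R]_n) (H : 'M[R]_n),
    forall x, q x = c + dot g x + dot x (H *m x).

Definition pt {R : realType} (a b : R) : 'cV[R]_2 :=
  \col_(i < 2) (if i == ord0 then a else b).

Definition plane {R : realType} {n : nat} (x d1 d2 : 'cV[R]_n) :
    set 'cV[R]_n :=
  [set y | exists a b : R, y = x + a *: d1 + b *: d2].

(* The formula makes sense on the whole space; only its values on
   [plane x d1 d2] are meaningful. *)
Definition planeT {R : realType} {n : nat} (x d1 d2 y : 'cV[R]_n) : 'cV[R]_2 :=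
  pt (dot (y - x) d1) (dot (y - x) d2).

Definition planeTinv {R : realType} {n : nat} (x d1 d2 : 'cV[R]_n)
    (u : 'cV[R]_2) : 'cV[R]_n :=
  x + u ord0 ord0 *: d1 + u ord_max ord0 *: d2.

Lemma dotDl {R : realType} {n : nat} (u v w : 'cV[R]_n) :
  dot (u + v) w = dot u w + dot v w.
Proof. by rewrite /dot linearD mulmxDl mxE. Qed.

Lemma dotZl {R : realType} {n : nat} (a : R) (u v : 'cV[R]_n) :
  dot (a *: u) v = a * dot u v.
Proof. by rewrite /dot linearZ -scalemxAl mxE. Qed.

Lemma dotC {R : realType} {n : nat} (u v : 'cV[R]_n) : dot u v = dot v u.
Proof. by rewrite /dot -[u^T *m v]trmxK trmx_mul trmxK mxE. Qed.

Lemma planeTinvK {R : realType} {n : nat} (x d1 d2 : 'cV[R]_n) :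
  orthonormal2 d1 d2 -> cancel (planeTinv x d1 d2) (planeT x d1 d2).
Proof.
move=> [d11 d22 d12] u; apply/colP => i.
have -> : planeT x d1 d2 (planeTinv x d1 d2 u) =
    pt (dot (u ord0 ord0 *: d1 + u ord_max ord0 *: d2) d1)
       (dot (u ord0 ord0 *: d1 + u ord_max ord0 *: d2) d2).
  by rewrite /planeT /planeTinv -(addrA x) (addrC x) addrK.
rewrite !dotDl !dotZl.
rewrite d11 d22 d12 (dotC d2) d12 !mulr0 !mulr1 addr0 add0r mxE.
case: ifPn => [/eqP-> //|i0]; congr (u _ _); apply/val_inj.
by case: i i0 => -[|[|]].
Qed.

Lemma planeTK {R : realType} {n : nat} (x d1 d2 : 'cV[R]_n) :
  orthonormal2 d1 d2 ->
  {in plane x d1 d2, cancel (planeT x d1 d2) (planeTinv x d1 d2)}.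
Proof.
move=> d12 y /[!inE] -[a [b ->]].
suff -> : x + a *: d1 + b *: d2 = planeTinv x d1 d2 (pt a b).
  by rewrite planeTinvK.
by rewrite /planeTinv !mxE.
Qed.

Definition ftilde {R : realType} {n : nat} (f : 'cV[R]_n -> R)
    (x d1 d2 : 'cV[R]_n) : 'cV[R]_2 -> R :=
  f \o planeTinv x d1 d2.

Definition y1pt {R : realType} {n : nat} (x d2 : 'cV[R]_n) (Delta : R) :
    'cV[R]_n :=
  x + Delta *: d2.

Definition y2pt {R : realType} {n : nat} (f : 'cV[R]_n -> R)
    (x d2 : 'cV[R]_n) (Delta : R) : 'cV[R]_n :=
  if f (y1pt x d2 Delta) <= f x then x + (2 * Delta) *: d2
  else x - Delta *: d2.

Definition minimizer_in {R : realType} {T : Type} (f : T -> R) (A : set T)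
    (y : T) : Prop :=
  A y /\ forall z, A z -> f y <= f z.

Definition affine_map {R : realType} {m n : nat} (phi : 'cV[R]_m -> 'cV[R]_n) :
    Prop :=
  exists (o : 'cV[R]_n) (M : 'M[R]_(n, m)), forall u, phi u = o + M *m u.

Definition unisolvent {R : realType} (w : 'I_6 -> 'cV[R]_2) : Prop :=
  forall v : 'I_6 -> R,
    exists! q : 'cV[R]_2 -> R, quadratic q /\ forall i, q (w i) = v i.

(* [plane xp p1 p2] is the affine plane of the previous iteration, [phi] the
   inverse of an affine coordinate system on it in which [x + a *: d1] has
   coordinates (a, 0) (so the plane contains that line), and [phi (w i)] are
   the six interpolation points. *)
Definition previous_model {R : realType} {n : nat} (f : 'cV[R]_n -> R)
    (x d1 xp p1 p2 : 'cV[R]_n) (Qp : 'cV[R]_2 -> R) : Prop :=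
  [/\ quadratic Qp,
      Qp (pt 0 0) = f x &
      exists (phi : 'cV[R]_2 -> 'cV[R]_n) (w : 'I_6 -> 'cV[R]_2),
        [/\ affine_map phi,
            set_bij setT (plane xp p1 p2) phi,
            forall a : R, phi (pt a 0) = x + a *: d1,
            unisolvent w &
            forall i, Qp (w i) = f (phi (w i))]].

Definition axis_sqdist {R : realType} (P Q : 'cV[R]_2 -> R) : \bar R :=
  (\int[lebesgue_measure]_(a in [set: R])
     ((P (pt a 0) - Q (pt a 0)) ^+ 2)%:E)%E.

Definition feasible {R : realType} {n : nat} (f : 'cV[R]_n -> R)
    (x d1 d2 : 'cV[R]_n) (Z : set 'cV[R]_n) (Q : 'cV[R]_2 -> R) : Prop :=
  quadratic Q /\ forall z, Z z -> Q (planeT x d1 d2 z) = f z.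

Definition subproblem_solution {R : realType} {n : nat} (f : 'cV[R]_n -> R)
    (x d1 d2 : 'cV[R]_n) (Z : set 'cV[R]_n) (Qp Q : 'cV[R]_2 -> R) : Prop :=
  feasible f x d1 d2 Z Q /\
  forall Q', feasible f x d1 d2 Z Q' ->
    (axis_sqdist Q Qp <= axis_sqdist Q' Qp)%E.

(* Main.v *)
(* A quadratic function composed with an affine map is quadratic, so by
   unisolvence the previous model coincides with [f] on its whole plane, hence
   with [f~] on the axis. As [f~] is feasible, the optimal value is then [0], and
   all three integrals vanish. *)
Require Import Defs.
From HB Require Import structures.
From mathcomp Require Import all_boot all_order all_algebra.
From mathcomp Require Import all_classical all_reals all_analysis.
From mathcomp Require Import ring.

Set Implicit Arguments.
Unset Strict Implicit.

Import Order.TTheory GRing.Theory Num.Theory.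
Local Open Scope classical_set_scope.
Local Open Scope ring_scope.

Lemma dotDr (R : realType) (n : nat) (u v w : 'cV[R]_n) :
  dot u (v + w) = dot u v + dot u w.
Proof. by rewrite dotC dotDl !(dotC u). Qed.

Lemma dot_mulmxr (R : realType) (m n : nat) (M : 'M[R]_(n, m)) (u : 'cV[R]_n)
    (v : 'cV[R]_m) : dot u (M *m v) = dot (M^T *m u) v.
Proof. by rewrite /dot trmx_mul trmxK mulmxA. Qed.

Lemma quadratic_comp_affine (R : realType) (m n : nat) (f : 'cV[R]_n -> R)
    (phi : 'cV[R]_m -> 'cV[R]_n) :
  quadratic f -> affine_map phi -> quadratic (f \o phi).
Proof.
move=> [c [g [H fE]]] [b [M phiE]].
(* Coefficients of the expansion of [f (b + M u)] by degree in [u]. Since [H] need not be symmetric,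
   the two cross terms contribute [H^T b] and [H b] separately to the linear part. *)
exists (c + dot g b + dot b (H *m b)).
exists (M^T *m g + M^T *m (H^T *m b) + M^T *m (H *m b)), (M^T *m (H *m M)).
move=> u; rewrite /= fE phiE !mulmxDr !dotDl !dotDr -!mulmxA.
rewrite -!dot_mulmxr (dot_mulmxr M^T) trmxK (dotC (H *m b)).
ring.
Qed.

Lemma affine_planeTinv (R : realType) (n : nat) (x d1 d2 : 'cV[R]_n) :
  affine_map (planeTinv x d1 d2).
Proof.
exists x, (\matrix_(i, j) if j == ord0 then d1 i ord0 else d2 i ord0); move=> u.
apply/colP => i; rewrite /planeTinv !mxE big_ord_recl big_ord1 !mxE /= -addrA.
rewrite ![_ * u _ _]mulrC; congr (_ + (_ + u _ _ * _)).
(* The second index produced by the sum over ['I_2] is [lift ord0 ord0], which has the same value as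
   [ord_max]. *)
exact: val_inj.
Qed.

(** Both functions solve the interpolation problem with data [q \o w], whose solution is unique. *)
Lemma unisolvent_inj (R : realType) (w : 'I_6 -> 'cV[R]_2)
    (p q : 'cV[R]_2 -> R) :
  unisolvent w -> quadratic p -> quadratic q ->
  (forall i, p (w i) = q (w i)) -> p = q.
Proof.
move=> /(_ (q \o w)) [r [_ r_uniq]] qp qq pq.
by rewrite -(r_uniq p) // -(r_uniq q).
Qed.

Lemma previous_model_axis (R : realType) (n : nat) (f : 'cV[R]_n -> R)
    (x d1 d2 xp p1 p2 : 'cV[R]_n) (Qp : 'cV[R]_2 -> R) (a : R) :
  quadratic f -> previous_model f x d1 xp p1 p2 Qp ->
  Qp (pt a 0) = ftilde f x d1 d2 (pt a 0).
Proof.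
move=> qf [qQp _ [phi [w [aphi _ phi_axis uw Qpw]]]].
(* [Qp] and [f \o phi] are quadratics that agree at the six nodes, so they are equal; on the axis,
   [phi] and [planeTinv] give the same point, as the coefficient of [d2] is 0. *)
rewrite (unisolvent_inj uw qQp (quadratic_comp_affine qf aphi) Qpw) /=.
by rewrite /ftilde /planeTinv /= phi_axis !mxE /= scale0r addr0.
Qed.

(** On the plane [planeTinv] undoes [planeT], so [f~] reproduces [f] at any choice of points
    there. *)
Lemma feasible_ftilde (R : realType) (n : nat) (f : 'cV[R]_n -> R)
    (x d1 d2 : 'cV[R]_n) (Z : set 'cV[R]_n) :
  quadratic f -> orthonormal2 d1 d2 -> Z `<=` plane x d1 d2 ->
  feasible f x d1 d2 Z (ftilde f x d1 d2).
Proof.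
move=> qf d12 Zplane; split=> [|z /Zplane zP].
  exact: quadratic_comp_affine (affine_planeTinv _ _ _).
by rewrite /ftilde /= planeTK // inE.
Qed.

Lemma y1pt_axis (R : realType) (n : nat) (x d2 : 'cV[R]_n) (Delta : R) :
  exists b, y1pt x d2 Delta = x + b *: d2.
Proof. by exists Delta. Qed.

Lemma y2pt_axis (R : realType) (n : nat) (f : 'cV[R]_n -> R)
    (x d2 : 'cV[R]_n) (Delta : R) :
  exists b, y2pt f x d2 Delta = x + b *: d2.
Proof.
rewrite /y2pt; case: ifP => _; first by exists (2 * Delta).
by exists (- Delta); rewrite scaleNr.
Qed.

Lemma interpolation_points_plane (R : realType) (n : nat) (f : 'cV[R]_n -> R)
    (x d1 d2 : 'cV[R]_n) (Delta : R) (ymin : 'cV[R]_n) :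
  [set y1pt x d2 Delta; y2pt f x d2 Delta] ymin ->
  [set z | [\/ z = x, z = y1pt x d2 Delta, z = y2pt f x d2 Delta
             | z = ymin + Delta *: d1]] `<=` plane x d1 d2.
Proof.
have [b1 ->] := y1pt_axis x d2 Delta; have [b2 ->] := y2pt_axis f x d2 Delta.
move=> yminE z /= [] ->.
- by exists 0, 0; rewrite !scale0r !addr0.
- by exists 0, b1; rewrite scale0r addr0.
- by exists 0, b2; rewrite scale0r addr0.
(* [ymin] is one of two points on the line through [x] along [d2]; the shift by [Delta *: d1] makes
   the first coordinate [Delta]. *)
- by case: yminE => ->; [exists Delta, b1 | exists Delta, b2]; rewrite addrAC.
Qed.

Lemma axis_sqdist_ge0 (R : realType) (P Q : 'cV[R]_2 -> R) :
  (0 <= axis_sqdist P Q)%E.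
Proof. by apply: integral_ge0 => a _; rewrite lee_fin sqr_ge0. Qed.

Lemma axis_sqdist_eq0 (R : realType) (P Q : 'cV[R]_2 -> R) :
  (forall a, P (pt a 0) = Q (pt a 0)) -> axis_sqdist P Q = 0%E.
Proof.
by move=> PQ; apply: integral0_eq => a _; rewrite PQ subrr expr0n.
Qed.

(* In [\bar R], [+oo - +oo = -oo] while the left-hand side is nonnegative, so
   the equality cannot hold through an undefined difference. *)
Theorem theorem4p4 (R : realType) (n : nat) (f : 'cV[R]_n -> R)
    (x d1 d2 : 'cV[R]_n) (Delta : R) (ymin : 'cV[R]_n)
    (xp p1 p2 : 'cV[R]_n) (Qp Q : 'cV[R]_2 -> R)
    (hf : quadratic f)
    (hDelta : 0 < Delta)
    (hd : orthonormal2 d1 d2)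
    (hymin : minimizer_in f [set y1pt x d2 Delta; y2pt f x d2 Delta] ymin)
    (hp : orthonormal2 p1 p2)
    (hQp : previous_model f x d1 xp p1 p2 Qp)
    (hQ : subproblem_solution f x d1 d2
            [set z | [\/ z = x, z = y1pt x d2 Delta, z = y2pt f x d2 Delta
                       | z = ymin + Delta *: d1]] Qp Q) :
  axis_sqdist Q (ftilde f x d1 d2) =
  (axis_sqdist Qp (ftilde f x d1 d2) - axis_sqdist Q Qp)%E.
Proof.
have QpE a := previous_model_axis d2 a hf hQp.
have [ymin_in _] := hymin; have [_ Qmin] := hQ.
have Q0 : axis_sqdist Q Qp = 0%E.
  apply/eqP; rewrite eq_le axis_sqdist_ge0 andbT.
  (* The bound 0 is written as the objective value of the competitor [f~], so that optimality of [Q]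
     applies. *)
  rewrite -(axis_sqdist_eq0 (fun a => esym (QpE a))).
  exact/Qmin/feasible_ftilde/interpolation_points_plane.
(* The right-hand side is 0, turned back into [axis_sqdist Q Qp]: the two integrands then agree
   pointwise, and no almost-everywhere argument about [Q] is needed. *)
rewrite Q0 (axis_sqdist_eq0 QpE) sube0 -[RHS]Q0.
by apply: eq_integral => a _; rewrite QpE.
Qed.
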